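(* Let $\Gamma$ be an $n$-player game ($n\ge 2$) with finite nonempty pure strategy sets $S_1,\dots,S_n$ and payoff functions $A_1,\dots,A_n$. Suppose the real numbers $x^i_s$ ($i\in[n]$, $s\in S_i$) and $p^i$ ($i\in[n]$) satisfy $$\sum_{\hat{\mathbf{s}}\in S_{-i}}A_i[s,\hat{\mathbf{s}}]\prod_{s_j\in\hat{\mathbf{s}}}x^j_{s_j}\le p^i\quad\forall i\in[n],\ s\in S_i,$$ $$\sum_{i=1}^n\Big(\sum_{(s,\hat{\mathbf{s}})\in S_i\times S_{-i}} A_i[s,\hat{\mathbf{s}}]\,x^i_s\prod_{s_j\in\hat{\mathbf{s}}}x^j_{s_j}\Big)-\sum_{i=1}^n p^i\ge 0,$$ $$\sum_{s\in S_i}x^i_s=1\quad\forall i\in[n],\qquad 0\le x^i_s\le 1\quad\forall i\in[n],\ s\in S_i.$$ Then $(\mathbf{x}^1,\dots,\mathbf{x}^n)$, with $\mathbf{x}^i=(x^i_s)_{s\in S_i}$, is a (mixed) Nash equilibrium of $\Gamma$.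
   Context: Let $[n]=\{1,\dots,n\}$ be the set of players. Player $i$ has a finite nonempty set $S_i$ of pure strategies. $S_{-i}=S_1\times\dots\times S_{i-1}\times S_{i+1}\times\dots\times S_n$ is the set of pure strategy tuples of all players other than $i$. The payoff function of player $i$ is $A_i:S_1\times\dots\times S_n\to\mathbb{R}$; for $s\in S_i$ and $\hat{\mathbf{s}}\in S_{-i}$, $A_i[s,\hat{\mathbf{s}}]$ is the payoff of player $i$ when $i$ plays $s$ and the others play $\hat{\mathbf{s}}$. For $\hat{\mathbf{s}}=(s_j)_{j\ne i}\in S_{-i}$, the notation $\prod_{s_j\in\hat{\mathbf{s}}}x^j_{s_j}$ means $\prod_{j\ne i}x^j_{s_j}$. A mixed strategy of player $i$ is a vector $\mathbf{x}^i=(x^i_s)_{s\in S_i}$ with $x^i_s\ge 0$ and $\sum_{s\in S_i}x^i_s=1$ (pure strategies are special cases). A mixed strategy profile is a tuple $\mathbf{x}=(\mathbf{x}^1,\dots,\mathbf{x}^n)$ of mixed strategies; player $i$'s expected payoff is $\mathbb{E}[A_i[\mathbf{x}]]=\sum_{s\in S_i}x^i_s\sum_{\hat{\mathbf{s}}\in S_{-i}}A_i[s,\hat{\mathbf{s}}]\prod_{s_j\in\hat{\mathbf{s}}}x^j_{s_j}$. A profile $\mathbf{x}$ is a (mixed) Nash equilibrium if for every player $i$ and every mixed strategy $\mathbf{y}^i$ of player $i$, $\mathbb{E}[A_i[\mathbf{x}]]\ge\mathbb{E}[A_i[\mathbf{y}^i,\mathbf{x}^{-i}]]$, where $(\mathbf{y}^i,\mathbf{x}^{-i})$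 is $\mathbf{x}$ with $\mathbf{x}^i$ replaced by $\mathbf{y}^i$. *)

(* Defs.v *)
From mathcomp Require Import all_boot all_order all_algebra.
From mathcomp Require Import reals.

Set Implicit Arguments.
Unset Strict Implicit.
Unset Printing Implicit Defensive.

Import Order.TTheory GRing.Theory Num.Theory.
Local Open Scope ring_scope.

Definition opponent (n : nat) (i : 'I_n) := {j : 'I_n | j != i}.

Definition pure_profile (n : nat) (S : 'I_n -> finType) :=
  {dffun forall j : 'I_n, S j}.

(* The set S_{-i}, as dependent functions on the players j != i. *)
Definition opp_profile (n : nat) (S : 'I_n -> finType) (i : 'I_n) :=
  {dffun forall j : opponent i, S (val j)}.

(* (s, t) in S_i x S_{-i}, viewed as an element of S_1 x ... x S_n: it has
   entry s at i (transported along j = i) and entry t_j at every j != i. *)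
Definition pair_profile (n : nat) (S : 'I_n -> finType) (i : 'I_n)
    (s : S i) (t : opp_profile S i) : pure_profile S :=
  finfun (fun j : 'I_n =>
    match @eqVneq _ j i with
    | EqNotNeq e => eq_rect_r (fun k => S k : Type) s e
    | NeqNotEq ne => t (exist _ j ne)
    end).

Lemma pair_profile_self (n : nat) (S : 'I_n -> finType) (i : 'I_n)
    (s : S i) (t : opp_profile S i) : pair_profile s t i = s.
Proof.
rewrite ffunE; case: eqVneq => [e|ne]; first by rewrite (eq_axiomK e).
by exfalso; move: ne; rewrite eqxx.
Qed.

Lemma pair_profile_opp (n : nat) (S : 'I_n -> finType) (i : 'I_n)
    (s : S i) (t : opp_profile S i) (j : opponent i) :
  pair_profile s t (val j) = t j.
Proof.
case: j => j hj; rewrite ffunE /=.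
case: eqVneq => [e|ne]; first by exfalso; move: hj; rewrite e eqxx.
by rewrite (bool_irrelevance ne hj).
Qed.

Record game (R : realType) (n : nat) := Game {
  strategy : 'I_n -> finType;
  strategy_nonempty : forall i, (0 < #|strategy i|)%N;
  payoff : 'I_n -> pure_profile strategy -> R
}.

(* The payoff A_i[s, t] for s in S_i and t in S_{-i}. *)
Definition payoff_against (R : realType) (n : nat) (G : game R n) (i : 'I_n)
    (s : strategy G i) (t : opp_profile (strategy G) i) : R :=
  payoff i (pair_profile s t).

Definition is_mixed_strategy (R : realType) (T : finType) (y : T -> R) : Prop :=
  (forall s, 0 <= y s) /\ \sum_s y s = 1.

(* E[A_i[x]], defined for arbitrary families of real vectors x. *)
Definition expected_payoff (R : realType) (n : nat) (G : game R n)
    (x : forall i, strategy G i -> R) (i : 'I_n) : R :=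
  \sum_(s : strategy G i) x i s *
    \sum_(t : opp_profile (strategy G) i)
      payoff_against s t * \prod_(j : opponent i) x (val j) (t j).

(* [dfwith x y] is x with its component x^i replaced by y. *)
Definition nash_equilibrium (R : realType) (n : nat) (G : game R n)
    (x : forall i, strategy G i -> R) : Prop :=
  (forall i, is_mixed_strategy (x i)) /\
  forall (i : 'I_n) (y : strategy G i -> R), is_mixed_strategy y ->
    expected_payoff (dfwith x y) i <= expected_payoff x i.

(* Main.v *)
(* Each player's payoff is at most p^i, being an average of the payoffs of his
   pure strategies against x^{-i}; the total payoff being at least the sum of
   the p^i, every one of these inequalities is an equality.  The bound by p^i
   still holds after a unilateral deviation, because that leaves x^{-i}
   unchanged. *)

Require Import Defs.
From mathcomp Require Import all_boot all_order all_algebra.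
From mathcomp Require Import reals.

Set Implicit Arguments.
Unset Strict Implicit.
Unset Printing Implicit Defensive.

Import Order.TTheory GRing.Theory Num.Theory.
Local Open Scope ring_scope.

(** The weights sum to 1, so [c] is its own weighted average, and nonnegative weights preserve the
    termwise bound. Used both for [x i] and for a deviation [y]. *)
Lemma ler_mixed_sum (R : realType) (T : finType) (y f : T -> R) (c : R) :
  is_mixed_strategy y -> (forall s, f s <= c) -> \sum_s y s * f s <= c.
Proof.
move=> [y_ge0 y_sum] f_le; rewrite -[leRHS]mul1r -y_sum mulr_suml.
by apply: ler_sum => s _; apply: ler_wpM2l.
Qed.

(** The inner products range over [j != i] only, where [dfwith x y] agrees with [x]; thus [hbest],
    stated for [x], still bounds the inner sums after a deviation. *)
Lemma expected_payoff_dfwith (R : realType) (n : nat) (G : game R n)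
    (x : forall i, strategy G i -> R) (i : 'I_n) (y : strategy G i -> R) :
  expected_payoff (dfwith x y) i =
  \sum_(s : strategy G i) y s *
    \sum_(t : opp_profile (strategy G) i)
      payoff_against s t * \prod_(j : opponent i) x (val j) (t j).
Proof.
rewrite /expected_payoff dfwith_in; apply: eq_bigr => s _; congr (_ * _).
apply: eq_bigr => t _; congr (_ * _); apply: eq_bigr => j _.
by rewrite dfwith_out // eq_sym (valP j).
Qed.

(** Links the sums over pairs in [htotal] to the nested sums of [expected_payoff]. *)
Lemma expected_payoff_pair (R : realType) (n : nat) (G : game R n)
    (x : forall i, strategy G i -> R) (i : 'I_n) :
  \sum_(st : strategy G i * opp_profile (strategy G) i)
    payoff_against st.1 st.2 * x i st.1 *
    \prod_(j : opponent i) x (val j) (st.2 j) = expected_payoff x i.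
Proof.
rewrite -(pair_bigA _ (fun s t => payoff_against s t * x i s *
  \prod_(j : opponent i) x (val j) (t j))) /=.
apply: eq_bigr => s _; rewrite mulr_sumr; apply: eq_bigr => t _.
by rewrite mulrA [x i s * _]mulrC.
Qed.

Theorem corollary2 (R : realType) (n : nat) (hn : (2 <= n)%N) (G : game R n)
    (x : forall i : 'I_n, strategy G i -> R) (p : 'I_n -> R)
    (hbest : forall (i : 'I_n) (s : strategy G i),
       \sum_(t : opp_profile (strategy G) i)
         payoff_against s t * \prod_(j : opponent i) x (val j) (t j) <= p i)
    (htotal :
       \sum_(i < n)
         (\sum_(st : strategy G i * opp_profile (strategy G) i)
            payoff_against st.1 st.2 * x i st.1 *
            \prod_(j : opponent i) x (val j) (st.2 j))
       - \sum_(i < n) p i >= 0)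
    (hsum : forall i : 'I_n, \sum_(s : strategy G i) x i s = 1)
    (hbnd : forall (i : 'I_n) (s : strategy G i), 0 <= x i s <= 1) :
  nash_equilibrium x.
Proof.
have x_mixed i : is_mixed_strategy (x i).
  by split=> // s; case/andP: (hbnd i s).
have E_le i : expected_payoff x i <= p i by apply: ler_mixed_sum.
split=> // i y y_mixed; apply: (@le_trans _ _ (p i)).
  by rewrite expected_payoff_dfwith; apply: ler_mixed_sum.
move: htotal; under eq_bigr do rewrite expected_payoff_pair.
rewrite subr_ge0 (bigD1 i) //= [leRHS](bigD1 i) //= => total.
(* With [E j] the payoff under [x] and sums over [j != i]: [p i + \sum p j <= E i + \sum E j <= E i
   + \sum p j]. Cancelling [\sum p j] leaves [p i <= E i]. *)
have others : \sum_(j < n | j != i) expected_payoff x j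
              <= \sum_(j < n | j != i) p j by apply: ler_sum.
by rewrite -(lerD2r (\sum_(j < n | j != i) p j)) (le_trans total) // lerD2l.
Qed.
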